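(* Let $d=2$, and let $\mathcal{M}=(\mathcal{T},\mathcal{E},\mathcal{P})$ be a mesh of $\Omega\subset\mathbb{R}^2$ which is regular with parameters $\mu,\lambda\in(0,\frac12]$ and admissible, i.e. $[x_K,x_L]$ is orthogonal to $\sigma$ for all $\sigma\in\mathcal{E}_{KL}$. Let $\beta^0_\star>0$ be the constant, depending only on $\Omega$ and $\lambda$, of the discrete Trudinger inequality for zero average functions recalled in the context, and define $M_\star=\beta^0_\star/4$. Then, for any $u,v\in\mathbb{R}^{\mathcal{T}}$ such that $u$ is non-negative component-wise and $$M=\sum_{K\in\mathcal{T}}|K|u_K<M_\star ,$$ one has $$\mathcal{H}^{\mathcal{M}}(u,v)\ge\delta\,|v|_{1,2}^2-C-M\bar v,\qquad \bar v=\frac1{|\Omega|}\sum_{K\in\mathcal{T}}|K|v_K,$$ for some $\delta>0$ and $C>0$ depending only on $M$, $\beta^0_\star$, $\Omega$ and $\lambda$, where $$\mathcal{H}^{\mathcal{M}}(u,v)=\sum_{K\in\mathcal{T}}|K|\big(u_K\ln u_K-u_Kv_K\big)+\frac12\sum_{\sigma\in\mathcal{E}_{\rm int},\ \sigma\in\mathcal{E}_{KL}}\frac{|\sigma|}{\mathrm{d}_\sigma}(v_L-v_K)^2 .$$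
   Context: Domain. Here $d=2$ and $\Omega\subset\mathbb{R}^d$ is a bounded, connected, open polyhedral set, i.e. an open set whose closure equals the closure of a finite union of polyhedra, a polyhedron being a bounded intersection of finitely many half-spaces (possibly non-convex); $\Omega$ is moreover a Lipschitz domain. $|\cdot|$ denotes the Euclidean norm of vectors, and for sets the $d$- or $(d-1)$-dimensional Hausdorff measure, as appropriate. $B(a,r)$ is the open ball of center $a$ and radius $r$ in $\mathbb{R}^d$, and $B_{d'}$ is the unit open ball of $\mathbb{R}^{d'}$. Mesh. A mesh $\mathcal{M}=(\mathcal{T},\mathcal{E},\mathcal{P})$ of $\Omega$ consists of a set $\mathcal{T}$ of open connected polyhedral subsets of $\Omega$ (cells), a set $\mathcal{E}$ of non-empty relatively open connected polyhedral subsets of hyperplanes of $\mathbb{R}^d$ (faces), and a family $\mathcal{P}=(x_K)_{K\in\mathcal{T}}$ of points of $\Omega$ (cell centers), such that: (i) $\overline\Omega=\bigcup_{K\in\mathcal{T}}\overline K$; (ii) for each $K\in\mathcal{T}$ there is $\mathcal{E}_K\subset\mathcal{E}$ with $\partial K=\bigcup_{\sigma\in\mathcal{E}_K}\overline\sigma$ and $|\sigma\cap\sigma'|=0$ for distinct $\sigma,\sigma'\in\mathcal{E}_K$, and $\mathcal{E}=\bigcup_K\mathcal{E}_K$; (iii) for $K\ne L$ in $\mathcal{T}$, either $|\overline K\cap\partial L|=|\partial K\cap\overline L|=0$, or $\mathcal{E}_{KL}:=\mathcal{E}_K\cap\mathcal{E}_L$ is non-empty and $\overline K\cap\overline L=\bigcup_{\sigma\in\mathcal{E}_{KL}}\overline\sigma$;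 the set of interior faces is $\mathcal{E}_{\rm int}=\{\sigma\in\mathcal{E}:\exists K\neq L,\ \sigma\in\mathcal{E}_{KL}\}$; (iv) with $\mathcal{E}_{\rm ext}=\{\sigma\in\mathcal{E}:\sigma\subset\partial\Omega\}$, for each $K$ either $|\overline K\cap\partial\Omega|=0$ or $\overline K\cap\partial\Omega=\bigcup_{\sigma\in\mathcal{E}_K\cap\mathcal{E}_{\rm ext}}\overline\sigma$; (v) $x_K\in K$ for all $K$. For $\sigma\in\mathcal{E}_{\rm int}$ the pair $\{K,L\}$ with $\sigma\in\mathcal{E}_{KL}$ is unique, and $\mathrm{d}_\sigma:=|x_K-x_L|$. The mesh size is $h=\max_{K\in\mathcal{T}}\operatorname{diam}(K)$. Regularity. The mesh is regular with parameters $\mu,\lambda\in(0,\frac12]$ if every $K\in\mathcal{T}$ is star-shaped with respect to the ball $B(x_K,\mu h)$, and $\lambda^{d-1}h^{d-1}|B_{d-1}|\le|\sigma|$ for every $\sigma\in\mathcal{E}$. Dual mesh and seminorm. $P_{K\sigma}$ is the open $d$-dimensional pyramid with base $\sigma\in\mathcal{E}_K$ and vertex $x_K$. For $\sigma\in\mathcal{E}_{\rm int}$, $\sigma\in\mathcal{E}_{KL}$, the diamond cell $D_\sigma$ is the interior of $\overline{P_{K\sigma}\cup P_{L\sigma}}$. For $v\in\mathbb{R}^{\mathcal{T}}$, $|v|_{1,2}=\big(\sum_{\sigma\in\mathcal{E}_{\rm int},\,\sigma\in\mathcal{E}_{KL}}|\sigma|^2|D_\sigma|^{-1}|v_L-v_K|^2\big)^{1/2}$.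 The constant $\beta^0_\star$. The discrete Trudinger inequality for zero average functions (for $d=2$) states that there is $\beta^0_\star>0$ depending only on $\Omega$ and $\lambda$ such that for all $0<\beta<\beta^0_\star$ there is $C_\beta>0$ depending only on $\Omega,\lambda,\beta$ with $\sum_{K\in\mathcal{T}}|K|\exp|v_K-\bar v|\le C_\beta\exp\big(\frac1\beta|v|_{1,2}^2\big)$ for every mesh of $\Omega$ regular with parameters $\mu,\lambda$ and every $v\in\mathbb{R}^{\mathcal{T}}$; $\beta^0_\star$ is this constant. Conventions: $0\ln0=0$; a constant depending only on listed data is independent of everything else, in particular of the mesh and of $u,v$. *)

(* Defs.v *)
From HB Require Import structures.
From mathcomp Require Import all_boot all_order all_algebra.
From mathcomp Require Import all_classical all_reals all_analysis.

Set Implicit Arguments.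
Unset Strict Implicit.
Unset Printing Implicit Defensive.
Import Order.TTheory GRing.Theory Num.Theory.
Import numFieldNormedType.Exports.

Local Open Scope classical_set_scope.
Local Open Scope ring_scope.

(* The plane is [R * R]. Its library norm is the sup norm: it yields the usual
   topology and bounded sets, but Euclidean lengths are measured by [enorm]. *)
Section Plane.
Context {R : realType}.
Local Notation plane := (R * R)%type.
Implicit Types (x y : plane) (A S : set plane).

Definition dot x y : R := x.1 * y.1 + x.2 * y.2.

Definition enorm x : R := Num.sqrt (dot x x).

Definition eball x (r : R) : set plane := [set y | enorm (y - x) < r].

Definition perp x : plane := (- x.2, x.1).

Definition segment x y : set plane :=
  [set x + t *: (y - x) | t in [set t : R | 0 <= t <= 1]].

Definition boundary A : set plane := closure A `\` A°.

(* The added 0 makes the diameter of the empty set 0 instead of -oo. *)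
Definition ediam A : \bar R :=
  ereal_sup (0%E |` [set (enorm (p.1 - p.2))%:E | p in A `*` A]).

Definition diam A : R := fine (ediam A).

(* In dimension 1 the normalizing factor |B_1| / 2 of the Hausdorff measure
   is 1. *)
Definition hausdorff1_pre (e : R) A : \bar R :=
  ereal_inf [set (\sum_(0 <= i <oo) ediam (U i))%E | U in
    [set U : nat -> set plane |
      A `<=` \bigcup_i U i /\ forall i, (ediam (U i) <= e%:E)%E]].

Definition hausdorff1 A : \bar R :=
  ereal_sup [set hausdorff1_pre e A | e in [set e : R | 0 < e]].

Definition length A : R := fine (hausdorff1 A).

Definition area A : R :=
  fine ((@lebesgue_measure R \x @lebesgue_measure R)%E A).

Definition line A :=
  exists a : plane, exists b : R, a != 0 /\ A = [set x | dot a x = b].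

(* [A] is the ambient affine space, either the plane or a line. A half-plane
   whose edge is parallel to the line [A] cuts out all of [A] or nothing, so
   it allows no further polyhedron of [A] than the half-lines do, except the
   empty one. *)
Definition polyhedron A (P : set plane) :=
  bounded_set P /\
  exists n (a : 'I_n -> plane) (b : 'I_n -> R),
    (forall i, a i != 0) /\
    P = A `&` [set x | forall i, dot (a i) x <= b i].

Definition polyhedral A S :=
  (exists2 U : set plane, open U & S = A `&` U) /\
  exists n (P : 'I_n -> set plane),
    (forall i, polyhedron A (P i)) /\
    closure S = closure (\bigcup_i P i).

(* Near each boundary point, [A] is the strict epigraph of a Lipschitz function
   in the orthonormal frame [(perp e, e)]. *)
Definition lipschitz_domain A :=
  forall x, boundary A x ->
    exists (e : plane) (r k : R) (g : R -> R),
      [/\ enorm e = 1, 0 < r, k.-lipschitz g &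
        A `&` eball x r = [set y | g (dot (perp e) y) < dot e y] `&` eball x r].

Definition polyhedral_domain A :=
  [/\ A !=set0, bounded_set A, connected A, polyhedral setT A &
      lipschitz_domain A].

Definition star_shaped A (B : set plane) :=
  forall x y, A x -> B y -> segment x y `<=` A.

(* The open pyramid with base [S] and vertex [x]. *)
Definition pyramid x S : set plane :=
  [set x + p.1 *: (p.2 - x) | p in [set t : R | 0 < t < 1] `*` S].

End Plane.

(* The sets of cells and of faces are indexed by finite types; injectivity of
   the indexing makes distinct indices stand for distinct sets. *)
Record mesh (R : realType) (Om : set (R * R)) := Mesh {
  cells : finType;
  faces : finType;
  cell : cells -> set (R * R);
  face : faces -> set (R * R);
  center : cells -> R * R;
  faces_of : cells -> {set faces};
  cell_inj : injective cell;
  face_inj : injective face;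
  cell_sub : forall K, cell K `<=` Om;
  cell_connected : forall K, connected (cell K);
  cell_polyhedral : forall K, polyhedral setT (cell K);
  face_neq0 : forall s, face s !=set0;
  face_connected : forall s, connected (face s);
  face_polyhedral : forall s, exists2 H, line H & polyhedral H (face s);
  mesh_cover : closure Om = \bigcup_K closure (cell K);
  mesh_boundary : forall K,
    boundary (cell K) = \bigcup_(s in [set s | s \in faces_of K])
                          closure (face s);
  mesh_disjoint : forall K s s', s \in faces_of K -> s' \in faces_of K ->
    s != s' -> hausdorff1 (face s `&` face s') = 0%E;
  mesh_faces : forall s, exists K, s \in faces_of K;
  mesh_interface : forall K L, K != L ->
    (hausdorff1 (closure (cell K) `&` boundary (cell L)) = 0%E /\
     hausdorff1 (boundary (cell K) `&` closure (cell L)) = 0%E) \/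
    ((exists s, s \in faces_of K :&: faces_of L) /\
     closure (cell K) `&` closure (cell L) =
       \bigcup_(s in [set s | s \in faces_of K :&: faces_of L])
         closure (face s));
  mesh_exterior : forall K,
    hausdorff1 (closure (cell K) `&` boundary Om) = 0%E \/
    closure (cell K) `&` boundary Om =
      \bigcup_(s in [set s | s \in faces_of K /\ face s `<=` boundary Om])
        closure (face s);
  center_in : forall K, cell K (center K)
}.

Section MeshNotions.
Context {R : realType} {Om : set (R * R)} (m : mesh Om).
Implicit Types (K L : cells m) (s : faces m) (u v : cells m -> R).

Definition mesh_size : R := \big[Num.max/0]_(K : cells m) diam (cell K).

Definition regular_mesh (mu lambda : R) :=
  (forall K, star_shaped (cell K) (eball (center K) (mu * mesh_size))) /\
  (forall s, ((lambda * mesh_size)%:E * lebesgue_measure (ball (0%R : R) 1%R)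
                <= hausdorff1 (face s))%E).

Definition admissible_mesh :=
  forall K L s, K != L -> s \in faces_of K :&: faces_of L ->
    forall y z, face s y -> face s z ->
      dot (center L - center K) (z - y) = 0.

Definition dcenter K L : R := enorm (center K - center L).

Definition diamond s K L : set (R * R) :=
  (closure (pyramid (center K) (face s) `|` pyramid (center L) (face s)))°.

(* The sum over the interior faces [s], where {K, L} is the pair of distinct
   cells sharing [s]. Ordering the indices of [K] and [L] counts the unordered
   pair once; it is used only with terms symmetric in [K] and [L]. *)
Definition sum_int (F : faces m -> cells m -> cells m -> R) : R :=
  \sum_(s : faces m) \sum_(K : cells m)
    \sum_(L : cells m | (enum_rank K < enum_rank L)%N &&
                        (s \in faces_of K :&: faces_of L)) F s K L.

Definition seminorm12 v : R :=
  Num.sqrt (sum_int (fun s K L =>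
    length (face s) ^+ 2 * (area (diamond s K L))^-1 * `|v L - v K| ^+ 2)).

Definition mass u : R := \sum_(K : cells m) area (cell K) * u K.

Definition average v : R := (area Om)^-1 * mass v.

(* [ln 0 = 0] in the library, whence 0 ln 0 = 0. *)
Definition energy u v : R :=
  \sum_(K : cells m) area (cell K) * (u K * ln (u K) - u K * v K) +
  2^-1 * sum_int (fun s K L =>
    length (face s) / dcenter K L * (v L - v K) ^+ 2).

End MeshNotions.

(* [beta0] is a constant of the discrete Trudinger inequality for zero average
   functions on [Om], for the regularity parameter [lambda]. *)
Definition trudinger_constant (R : realType) (Om : set (R * R))
    (lambda beta0 : R) :=
  0 < beta0 /\
  forall beta : R, 0 < beta -> beta < beta0 ->
    exists C : R, 0 < C /\
      forall mu : R, 0 < mu <= 2^-1 ->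
      forall m : mesh Om, regular_mesh m mu lambda ->
      forall v : cells m -> R,
        \sum_(K : cells m) area (cell K) * expR `|v K - average v|
          <= C * expR (beta^-1 * seminorm12 v ^+ 2).

(* Main.v *)
Require Import Defs.
From mathcomp Require Import all_boot all_order all_algebra.
From mathcomp Require Import all_classical all_reals all_analysis.
From mathcomp Require Import measurable_realfun ring lra.

Import Order.TTheory GRing.Theory Num.Theory.
Import numFieldNormedType.Exports.
Local Open Scope classical_set_scope.
Local Open Scope ring_scope.

(** Write X for the squared seminorm of v, V for its average and S for the sum
    of |sigma| / d_sigma (v_L - v_K)^2 over the interior faces, so that the
    diffusion part of the energy is S / 2.

    The entropy and the coupling term are bounded below by duality. The Legendre
    inequality u ln u >= u y + u - exp y, taken in every cell with
    y = v_K - V + k and weighted by |K|, bounds them by M (1 + k - V) minus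
    exp k times the sum of |K| exp |v_K - V| ([gibbs]). The Trudinger inequality
    with parameter beta bounds this last sum by C exp (X / beta), so the shift
    k = - X / beta turns the error into the constant C and leaves the loss
    M X / beta.

    On an admissible mesh a diamond is made of two triangles on the common base
    sigma, whose apexes lie on a line orthogonal to sigma; hence its area is at
    least |sigma| d_sigma / 2, which gives X <= 2 S ([seminorm12_le]). The
    diffusion part is then at least X / 4, and the choice of beta strictly
    between 4 M and beta0 leaves delta = 1 / 4 - M / beta > 0.

    The bulk of the work is this area estimate for the product Lebesgue
    measure and the Hausdorff length. Its two halves are
    [area_triangle_ge], obtained by pulling the unit simplex back through
    barycentric coordinates, and [hausdorff1_line_part], obtained by cutting a
    segment into equal pieces. A face is an interval of a line up to its end
    points ([connected_line_part]), which connects them. Only the lower bound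
    of the area is established: it holds whichever sides of sigma the two
    centers lie on ([kite_area_ge]). *)

(** * Lebesgue measure under affine maps *)

(** By uniqueness of Lebesgue measure it suffices to compare both sides on
    half-open intervals. *)
Lemma lebesgue_measure_affine (R : realType) (c d : R) (A : set R) :
    d != 0 -> measurable A ->
  lebesgue_measure ((fun y => c + d * y) @^-1` A) =
  (`|d|^-1%:E * lebesgue_measure A)%E.
Proof.
move=> d0 mA.
have d1 : 0 < `|d| by rewrite normr_gt0.
pose f : measurableTypeR R -> measurableTypeR R := fun y => c + d * y.
have mf : measurable_fun setT f.
  by apply: measurable_funD => //; exact: measurable_funM.
pose k : {nonneg R} := NngNum (ltW d1).
have -> : lebesgue_measure A = pushforward (mscale k lebesgue_measure) f A.
  apply: lebesgue_measure_unique => // _ [[a b]] _ <-.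
  move: (d0); rewrite neq_lt => /orP[dn|dp].
  - have E : f @^-1` `]a, b] = [set` `[(b - c) / d, (a - c) / d[].
      apply/seteqP; split=> y /=; rewrite /f !in_itv /= ltr_ndivlMr// ler_ndivrMr//;
      by move=> /andP[? ?]; apply/andP; split; lra.
    rewrite /= /pushforward /mscale E /= !lebesgue_measure_itv /= !lte_fin.
    rewrite ltr_nM2r ?invr_lt0// ltrD2r; case: ifPn => ab; last by rewrite mule0.
    by rewrite -!EFinD -EFinM ltr0_norm//; congr EFin; field.
  - have E : f @^-1` `]a, b] = [set` `](a - c) / d, (b - c) / d]].
      apply/seteqP; split=> y /=; rewrite /f !in_itv /= ltr_pdivrMr// ler_pdivlMr//;
      by move=> /andP[? ?]; apply/andP; split; lra.
    rewrite /= /pushforward /mscale E /= !lebesgue_measure_itv /= !lte_fin.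
    rewrite ltr_pM2r ?invr_gt0// ltrD2r; case: ifPn => ab; last by rewrite mule0.
    by rewrite -!EFinD -EFinM gtr0_norm//; congr EFin; field.
rewrite /pushforward /mscale /= muleA -EFinM mulVf ?mul1e//.
by rewrite gt_eqF.
Qed.

Section Area.
Context {R : realType}.
Local Notation plane := (R * R)%type.
Local Notation leb := (@lebesgue_measure R).
Local Notation mu := (leb \x leb)%E.

(** The sets are measured for the product sigma-algebra, not for the Borel
    sets of the product topology; the two meet because an open set is a
    countable union of squares with rational centers and half-sides. *)
Lemma measurable_open_plane (U : set plane) :
  open U -> measurable (U : set (measurableTypeR R * measurableTypeR R)).
Proof.
move=> oU.
pose box (p : rat * rat * rat) : set plane :=
  ball (ratr p.1.1 : R) (ratr p.2 : R) `*` ball (ratr p.1.2 : R) (ratr p.2 : R).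
have -> : U = \bigcup_(p in [set p | box p `<=` U]) box p.
  apply/seteqP; split=> [x Ux|x [p /= pU] px]; last exact: pU.
  have /nbhs_ballP[e /= e0 eU] : nbhs x U by exact: open_nbhs_nbhs.
  have e40 : e / 4 < e / 2 by lra.
  have [r] := rat_in_itvoo e40.
  rewrite in_itv /= => /andP[r1 r2].
  have [p] : exists p, ratr p \in `](x.1 - e/4), (x.1 + e/4)[.
    by apply: rat_in_itvoo; lra.
  rewrite in_itv /= => /andP[p1 p2].
  have [q] : exists p, ratr p \in `](x.2 - e/4), (x.2 + e/4)[.
    by apply: rat_in_itvoo; lra.
  rewrite in_itv /= => /andP[q1 q2].
  exists (p, q, r) => /=.
    move=> y [] /=; rewrite /ball /= !ltr_distlC => /andP[y1 y2] /andP[y3 y4].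
    by apply: eU; split; rewrite /ball /= ltr_distlC; apply/andP; split; lra.
  by split; rewrite /ball /= ltr_distlC; apply/andP; split; lra.
rewrite bigcup_mkcond; apply: countable_bigcupT_measurable => // p.
by case: ifPn => // _; apply: measurableX; exact: measurable_ball.
Qed.

(** Each vertical slice is an affine preimage of a slice of [A]. This map and its
    companion [area_affine_fst] along horizontal slices are the triangular
    factors out of which barycentric coordinates are composed. *)
Lemma area_affine_snd (r k s : R) (A : set plane) :
    s != 0 -> measurable (A : set (measurableTypeR R * measurableTypeR R)) ->
  mu ((fun z => (z.1, r * z.1 + s * z.2 + k)) @^-1` A) =
  (`|s|^-1%:E * mu A)%E.
Proof.
move=> s0 mA; rewrite /product_measure1.
rewrite -ge0_integralZl//; last exact: measurable_fun_xsection.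
apply: eq_integral => x _ /=.
rewrite -(@lebesgue_measure_affine _ (r * x + k))//; last exact: measurable_xsection.
have -> // : (fun y => r * x + k + s * y) = (fun y => r * x + s * y + k).
by apply/funext => y; ring.
Qed.

Lemma area_affine_fst (r k s : R) (A : set plane) :
    s != 0 -> measurable (A : set (measurableTypeR R * measurableTypeR R)) ->
  measurable ((fun z => (s * z.1 + r * z.2 + k, z.2)) @^-1` A
     : set (measurableTypeR R * measurableTypeR R)) ->
  mu ((fun z => (s * z.1 + r * z.2 + k, z.2)) @^-1` A) =
  (`|s|^-1%:E * mu A)%E.
Proof.
move=> s0 mA mB.
have E B : measurable (B : set (measurableTypeR R * measurableTypeR R)) ->
    mu B = (leb \x^ leb)%E B.
  by move=> mB'; apply: product_measure_unique => //= *; rewrite product_measure2E.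
rewrite !E// /product_measure2.
rewrite -ge0_integralZl//; last exact: measurable_fun_ysection.
apply: eq_integral => x _ /=.
rewrite -(@lebesgue_measure_affine _ (r * x + k))//; last exact: measurable_ysection.
have -> // : (fun y => r * x + k + s * y) = (fun y => s * y + r * x + k).
by apply/funext => y; ring.
Qed.

End Area.

(** * Area of a triangle *)

Section Triangle.
Context {R : realType}.
Local Notation plane := (R * R)%type.
Local Notation leb := (@lebesgue_measure R).
Local Notation mu := (leb \x leb)%E.
Implicit Types (x y z a b : plane) (A D : set plane).

Definition simplex : set plane :=
  [set z | [/\ 0 < z.1, 0 < z.2 & z.1 + z.2 < 1]].

Lemma continuous_fst : continuous (fst : plane -> R).
Proof. by move=> z; exact: cvg_fst. Qed.

Lemma continuous_snd : continuous (snd : plane -> R).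
Proof. by move=> z; exact: cvg_snd. Qed.

Lemma continuous_affine (r s k : R) :
  continuous (fun z : plane => r * z.1 + s * z.2 + k).
Proof.
move=> z; apply: cvgD; last exact: cvg_cst.
apply: cvgD; apply: cvgM.
- exact: cvg_cst.
- exact: continuous_fst.
- exact: cvg_cst.
- exact: continuous_snd.
Qed.

Lemma continuous_pair (f g : plane -> R) :
  continuous f -> continuous g -> continuous (fun z => (f z, g z)).
Proof. by move=> cf cg z; exact: (cvg_pair (cf z) (cg z)). Qed.

Lemma open_simplex : open simplex.
Proof.
have o (r s k : R) : open [set z : plane | r * z.1 + s * z.2 + k > 0].
  apply: (open_comp (D := [set y : R | y > 0])); last exact: open_gt.
  by move=> z _; exact: continuous_affine.
have -> : simplex = [set z | 1 * z.1 + 0 * z.2 + 0 > 0] `&`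
    [set z | 0 * z.1 + 1 * z.2 + 0 > 0] `&`
    [set z | (-1) * z.1 + (-1) * z.2 + 1 > 0].
  apply/seteqP; split=> z /=; first by case=> *; split; first split; lra.
  by case=> -[? ?] ?; split; lra.
by apply: openI => //; exact: openI.
Qed.

(** The simplex, its image under the symmetry of center (1/2, 1/2) and their
    common side cover the unit square; the symmetry preserves the area and the
    side is a null set. *)
Lemma area_simplex_ge : (2^-1%:E <= mu simplex)%E.
Proof.
have mS := measurable_open_plane _ open_simplex.
pose S' := (fun z : plane => (-1 * z.1 + 0 * z.2 + 1, z.2)) @^-1`
  ((fun z : plane => (z.1, 0 * z.1 + -1 * z.2 + 1)) @^-1` simplex).
pose N := (fun z : plane => (z.1, 1 * z.1 + 1 * z.2 + -1)) @^-1`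
   ([set: R] `*` [set 0]).
have oS1 : open ((fun z : plane => (z.1, 0 * z.1 + -1 * z.2 + 1)) @^-1` simplex).
  apply: open_comp; last exact: open_simplex.
  move=> z _; apply: (@continuous_pair fst (fun z => 0 * z.1 + -1 * z.2 + 1)).
    exact: continuous_fst.
  exact: continuous_affine.
have oS' : open S'.
  apply: open_comp; last exact: oS1.
  move=> z _; apply: (@continuous_pair (fun z => -1 * z.1 + 0 * z.2 + 1) snd).
    exact: continuous_affine.
  exact: continuous_snd.
have mS' := measurable_open_plane _ oS'.
have muS' : mu S' = mu simplex.
  rewrite area_affine_fst//; last exact: measurable_open_plane.
  rewrite area_affine_snd//.
  by rewrite normrN normr1 invr1 !mul1e.
have m1 : measurable ([set: R] `*` [set (0:R)]
     : set (measurableTypeR R * measurableTypeR R)).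
  by apply: measurableX.
(* A vertical shear flattens the side onto the first coordinate axis. *)
have muN : mu N = 0%E.
  rewrite area_affine_snd// normr1 invr1 mul1e product_measure1E//.
  by rewrite [X in (_ * X)%E](_ : _ = 0%E) ?mule0//; exact: lebesgue_measure_set1.
have mN : measurable (N : set (measurableTypeR R * measurableTypeR R)).
  rewrite -[N]setCK; apply: measurableC; apply: measurable_open_plane.
  rewrite (_ : ~` N = (fun z => 1 * z.1 + 1 * z.2 + -1) @^-1` ~` [set 0]).
    apply: open_comp; first by move=> z _; exact: continuous_affine.
    by apply: closed_openC; exact: closed_eq.
  apply/seteqP; split=> z /=; first by move=> h h0; apply: h.
  by move=> h [_ h0]; apply: h.
pose I : set R := `]0, 1[%classic.
pose Q : set plane := I `*` I.
have mQ : measurable (Q : set (measurableTypeR R * measurableTypeR R)).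
  by apply: measurableX; exact: measurable_itv.
have muQ : mu Q = 1%E.
  have mI : leb I = 1%E.
    by rewrite lebesgue_measure_itv /= lte_fin ltr01 oppr0 adde0.
  transitivity (leb I * leb I)%E; last by rewrite mI mule1.
  by apply: product_measure1E; exact: measurable_itv.
have : (mu Q <= mu (simplex `|` S' `|` N))%E.
  apply: le_measure; rewrite ?inE//; first by do 2 apply: measurableU => //.
  move=> z [] /=; rewrite /I /= !in_itv /= => /andP[z1 z2] /andP[z3 z4].
  have [h|h|h] := ltgtP (z.1 + z.2) 1.
  - by left; left; split.
  - by left; right; split => /=; lra.
  - by right; split => //=; lra.
have h1 : (mu (simplex `|` S' `|` N) <= mu (simplex `|` S') + mu N)%E.
  by apply: measureU2 => //; exact: measurableU.
have h2 : (mu (simplex `|` S') <= mu simplex + mu S')%E by exact: measureU2.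
move: h1 h2; rewrite muS' muN muQ adde0.
move=> h1 h2 h3; have {h1 h2 h3} := le_trans h3 (le_trans h1 h2).
case: (mu simplex) => [r| |] //=; last by move=> _; rewrite leey.
by rewrite -EFinD !lee_fin; lra.
Qed.

Definition cross (u w : plane) : R := u.1 * w.2 - u.2 * w.1.

(** The barycentric coordinates of [z] at [a] and [b], by Cramer's rule; the
    coordinate at [x] is one minus their sum. *)
Definition bary x a b z : plane :=
  (cross (z - x) (b - x) / cross (a - x) (b - x),
   cross (a - x) (z - x) / cross (a - x) (b - x)).

(** The open triangle is a preimage of the simplex, rather than an image, so that
    openness and area follow from continuity and from the affine change of
    variables; it is empty when the three points are aligned. *)
Definition triangle x a b : set plane := bary x a b @^-1` simplex.

Lemma continuous_bary x a b : continuous (bary x a b).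
Proof.
set D := cross (a - x) (b - x).
rewrite (_ : bary x a b = fun z : plane =>
  ((b - x).2 / D * z.1 + - ((b - x).1 / D) * z.2 +
     (x.2 * (b - x).1 - x.1 * (b - x).2) / D,
   - ((a - x).2 / D) * z.1 + (a - x).1 / D * z.2 +
     (x.1 * (a - x).2 - x.2 * (a - x).1) / D)).
  by apply: continuous_pair; exact: continuous_affine.
by apply/funext => z; rewrite /bary -/D /cross /=; congr pair; ring.
Qed.

Lemma open_triangle x a b : open (triangle x a b).
Proof.
apply: open_comp; last exact: open_simplex.
by move=> z _; exact: continuous_bary.
Qed.

Lemma triangleC x a b : triangle x a b = triangle x b a.
Proof.
have sw u w : cross u w = - cross w u by rewrite /cross; ring.
suff sub c d : triangle x c d `<=` triangle x d c by apply/seteqP; split.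
move=> z [/=]; rewrite /triangle /simplex /bary /=.
rewrite (sw (z - x)) (sw (c - x)) (sw (c - x)) !invrN !mulrN !mulNr !opprK.
by move=> ? ? ?; split=> //; rewrite addrC.
Qed.

(** Barycentric coordinates are an affine map of determinant one over
    cross (a - x) (b - x); factoring it as a lower times an upper triangular map
    requires one pivot to be nonzero, which exchanging [a] and [b] provides. *)
Lemma area_triangle_ge x a b : cross (a - x) (b - x) != 0 ->
  ((`|cross (a - x) (b - x)| / 2)%:E <= mu (triangle x a b))%E.
Proof.
wlog w0 : a b / (b - x).2 != 0.
  move=> H D0; have [b0|] := eqVneq (b - x).2 0; last by move=> ?; exact: H.
  have [a0|a0] := eqVneq (a - x).2 0.
    by move: D0; rewrite /cross a0 b0 mulr0 mul0r subrr eqxx.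
  have E : cross (a - x) (b - x) = - cross (b - x) (a - x) by rewrite /cross; ring.
  rewrite triangleC E normrN; apply: H => //.
  by rewrite -oppr_eq0 -E.
set u := a - x; set w := b - x in w0 *; set D := cross u w => D0.
(* [bary x a b] is [F1], which fixes the ordinate, followed by [F2], which
   fixes the abscissa. *)
pose k1 := (x.2 * w.1 - x.1 * w.2) / D.
pose k2 := (x.1 * u.2 - x.2 * u.1) / D + u.2 / w.2 * k1.
pose F1 (z : plane) : plane := (w.2 / D * z.1 + - (w.1 / D) * z.2 + k1, z.2).
pose F2 (z : plane) : plane :=
  (z.1, - (u.2 / w.2) * z.1 + w.2^-1 * z.2 + k2).
have FE z : bary x a b z = F2 (F1 z).
  rewrite /bary -/u -/w -/D /F2 /F1 /=; congr pair.
    by rewrite /cross /k1 /=; ring.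
  have wD : w.2^-1 = w.2^-1 * (u.1 * w.2 - u.2 * w.1) / D.
    by rewrite -[u.1 * w.2 - _]/D mulfK.
  rewrite [X in _ = _ + X * z.2 + _]wD /k2 /k1 /cross /=; field.
  by rewrite D0 w0.
have oB : open (F2 @^-1` simplex).
  apply: open_comp; last exact: open_simplex.
  move=> z _; apply: (@continuous_pair fst); first exact: continuous_fst.
  exact: continuous_affine.
have TE : triangle x a b = F1 @^-1` (F2 @^-1` simplex).
  by apply/seteqP; split=> z; rewrite /triangle /= FE.
have mB := measurable_open_plane _ oB.
have mT := measurable_open_plane _ (open_triangle x a b).
have -> : mu (triangle x a b) = (`|D|%:E * mu simplex)%E.
  rewrite TE area_affine_fst ?mulf_neq0 ?invr_neq0//; last by rewrite -TE.
  rewrite area_affine_snd ?invr_neq0//; last first.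
    exact: measurable_open_plane _ open_simplex.
  rewrite muleA -EFinM; congr (_%:E * _)%E.
  by rewrite !normrM !normrV ?unitfE// !invrK; field; rewrite !normr_eq0 D0 w0.
rewrite EFinM lee_pmul2l//; first exact: area_simplex_ge.
by rewrite lte_fin normr_gt0.
Qed.

Lemma triangle_pyramid x a b z : triangle x a b z ->
  exists t r, [/\ 0 < t < 1, 0 < r < 1 & z = x + t *: (a + r *: (b - a) - x)].
Proof.
rewrite /triangle /simplex /=; set p := cross _ _ / _; set q := cross _ _ / _.
move=> [p0 q0 pq].
have pq0 : 0 < p + q by lra.
have D0 : cross (a - x) (b - x) != 0.
  by apply/eqP => D0; move: p0; rewrite /p D0 invr0 mulr0 ltxx.
exists (p + q), (q / (p + q)); split; first by rewrite pq0.
  by rewrite divr_gt0//= ltr_pdivrMr// mul1r; lra.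
have E : z = x + (p *: (a - x) + q *: (b - x)).
  rewrite /p /q /cross; move: D0; rewrite /cross.
  case: x a b z {p q p0 q0 pq pq0} => [x1 x2] [a1 a2] [b1 b2] [z1 z2] /= D0.
  by congr pair => /=; rewrite /GRing.scale /=; field.
rewrite {1}E; congr (_ + _).
case: (x) (a) (b) => [x1 x2] [a1 a2] [b1 b2].
by congr pair => /=; rewrite /GRing.scale /=; field; rewrite gt_eqF.
Qed.

(** A point of the triangle lies on the same side of the line (ab) as the apex;
    the sign of the cross product tells that side. *)
Lemma triangle_cross x a b z : triangle x a b z ->
  exists2 t, 0 < t & cross (a - z) (b - z) = t * cross (a - x) (b - x).
Proof.
rewrite /triangle /simplex /=; set p := cross _ _ / _; set q := cross _ _ / _.
move=> [p0 q0 pq].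
have D0 : cross (a - x) (b - x) != 0.
  by apply/eqP => D0; move: p0; rewrite /p D0 invr0 mulr0 ltxx.
exists (1 - (p + q)); first by lra.
rewrite /p /q /cross; move: D0; rewrite /cross.
case: x a b z {p q p0 q0 pq} => [x1 x2] [a1 a2] [b1 b2] [z1 z2] /= D0.
by field.
Qed.

End Triangle.

(** * Two triangles on a common base *)

Section Kite.
Context {R : realType}.
Local Notation plane := (R * R)%type.
Local Notation leb := (@lebesgue_measure R).
Local Notation mu := (leb \x leb)%E.
Implicit Types (x y z a b c d : plane) (A D : set plane).

(** Both cross products are the length of the base times a signed height. Their
    difference is the cross product of [d - c] with the base, to which
    Lagrange's identity applies. *)
Lemma kite_cross a b c d : dot (d - c) (b - a) = 0 ->
  `|cross (a - c) (b - c) - cross (a - d) (b - d)| = enorm (b - a) * enorm (c - d).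
Proof.
rewrite /enorm => o.
rewrite -sqrtrM; last by rewrite /dot -!expr2 addr_ge0 ?sqr_ge0.
rewrite -sqrtr_sqr; congr Num.sqrt; apply/eqP; rewrite -subr_eq0; apply/eqP.
transitivity (- dot (d - c) (b - a) ^+ 2); last by rewrite o expr0n oppr0.
by rewrite /dot /cross /=; ring.
Qed.

(** If the apexes lie on opposite sides of the base, the triangles are disjoint
    and their heights add up to the distance of the apexes. Otherwise that
    distance is the difference of the heights, so the taller triangle alone is
    large enough. *)
Lemma kite_area_ge a b c d D :
    measurable (D : set (measurableTypeR R * measurableTypeR R)) ->
    triangle c a b `<=` D -> triangle d a b `<=` D ->
    dot (d - c) (b - a) = 0 ->
  ((enorm (b - a) * enorm (c - d) / 2)%:E <= mu D)%E.
Proof.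
move=> mD; have mT x := measurable_open_plane _ (open_triangle x a b).
move=> cD dD /kite_cross <-.
have half x : triangle x a b `<=` D ->
    ((`|cross (a - x) (b - x)| / 2)%:E <= mu D)%E.
  move=> xD; have [->|x0] := eqVneq (cross (a - x) (b - x)) 0.
    by rewrite normr0 mul0r.
  apply: (le_trans (area_triangle_ge _ _ _ x0)).
  by apply: le_measure; rewrite ?inE.
have {half} [hc hd] := (half _ cD, half _ dD).
set p := cross (a - c) _ in hc *; set q := cross (a - d) _ in hd *.
have [pq|pq] := ltP (p * q) 0; last first.
  have [qp|qp] := leP `|q| `|p|.
    apply: le_trans hc; rewrite lee_fin ler_pM2r ?invr_gt0//; move: qp.
    by case: (ger0P (p - q)); case: (ger0P p); case: (ger0P q); nra.
  apply: le_trans hd; rewrite lee_fin ler_pM2r ?invr_gt0//; move: qp.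
  by case: (ger0P (p - q)); case: (ger0P p); case: (ger0P q); nra.
have p0 : p != 0 by apply/eqP => p0; rewrite p0 mul0r ltxx in pq.
have q0 : q != 0 by apply/eqP => q0; rewrite q0 mulr0 ltxx in pq.
have dis : triangle c a b `&` triangle d a b = set0.
  rewrite -subset0 => z [] /triangle_cross[t t0 tE] /triangle_cross[u u0].
  rewrite tE -/p -/q => E; suff : (t * p) * (u * q) < 0 by rewrite E; nra.
  by rewrite mulrACA pmulr_rlt0// mulr_gt0.
apply: (@le_trans _ _ (mu (triangle c a b `|` triangle d a b))); last first.
  apply: le_measure; rewrite ?inE//; first exact: measurableU.
  by move=> z [/cD|/dD].
rewrite measureU//.
apply: (@le_trans _ _ ((`|p| / 2)%:E + (`|q| / 2)%:E)%E).
  by rewrite -EFinD lee_fin -mulrDl ler_pM2r ?invr_gt0// ler_normB.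
by apply: leeD; exact: area_triangle_ge.
Qed.

End Kite.

(** * Length of a segment *)

Section Hausdorff.
Context {R : realType}.
Local Notation plane := (R * R)%type.
Implicit Types (A B : set plane).

Lemma ediam_ge0 A : (0 <= ediam A)%E.
Proof. by apply: ereal_sup_ubound; left. Qed.

Lemma hausdorff1_ge0 A : (0 <= hausdorff1 A)%E.
Proof.
apply: (@le_trans _ _ (hausdorff1_pre 1 A)).
  apply/ereal_infP => _ [U _ <-].
  by apply: nneseries_ge0 => *; exact: ediam_ge0.
by apply: ereal_sup_ubound; exists 1 => /=.
Qed.

Lemma le_hausdorff1 A B : A `<=` B -> (hausdorff1 A <= hausdorff1 B)%E.
Proof.
move=> AB; apply/ereal_supP => _ [e e0 <-].
apply: (@le_trans _ _ (hausdorff1_pre e B)).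
  apply/ereal_infP => _ [U [BU Ue] <-]; apply: ereal_inf_lbound.
  by exists U => //; split=> // x /AB /BU.
by apply: ereal_sup_ubound; exists e.
Qed.

Definition line_part (p e : plane) (J : set R) : set plane :=
  [set p + t *: e | t in J].

Lemma enormZ (t : R) (e : plane) : enorm (t *: e) = `|t| * enorm e.
Proof.
rewrite /enorm -sqrtr_sqr -sqrtrM ?sqr_ge0//; congr Num.sqrt.
by rewrite /dot /= /GRing.scale /=; ring.
Qed.

Lemma ediam_line_part (p e : plane) (l r : R) : enorm e = 1 -> l <= r ->
  (ediam (line_part p e `[l, r]) <= (r - l)%:E)%E.
Proof.
move=> e1 lr; apply/ereal_supP => _ [->|[[_ _] [/= [t + <-] [u + <-]] <-]].
  by rewrite lee_fin subr_ge0.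
rewrite /= !in_itv /= => /andP[? ?] /andP[? ?].
rewrite opprD addrACA subrr add0r -scalerBl enormZ e1 mulr1 lee_fin ler_norml.
by apply/andP; split; lra.
Qed.

Lemma subdivide (l d t : R) n : l <= t <= l + n.+1%:R * d ->
  exists2 i, (i < n.+1)%N & l + i%:R * d <= t <= l + i.+1%:R * d.
Proof.
elim: n => [|n IH] /andP[lt tr].
  by exists 0%N => //; rewrite mul0r addr0 lt tr.
have [h|h] := leP t (l + n.+1%:R * d).
  have [|i ni ti] := IH; first by rewrite lt.
  by exists i => //; exact: ltnW.
by exists n.+1 => //; rewrite (ltW h) tr.
Qed.

(** Equal pieces of the segment have diameters that sum up to its length, however
    fine the pieces are. *)
Lemma hausdorff1_line_part (p e : plane) (l r : R) : enorm e = 1 -> l <= r ->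
  (hausdorff1 (line_part p e `[l, r]) <= (r - l)%:E)%E.
Proof.
move=> e1 lr; apply/ereal_supP => _ [eps /= eps0 <-].
have [n nE] : exists n : nat, (r - l) / eps < n%:R.
  by exists (Num.truncn ((r - l) / eps)).+1; exact: truncnS_gt.
pose d := (r - l) / n.+1%:R.
have d0 : 0 <= d by rewrite divr_ge0// subr_ge0.
have de : d <= eps.
  rewrite /d ler_pdivrMr// -ler_pdivrMl// mulrC (le_trans (ltW nE))//.
  by rewrite ler_nat.
pose U i := if (i < n.+1)%N
  then line_part p e `[l + i%:R * d, l + i.+1%:R * d] else set0.
have ediam0 : ediam (set0 : set plane) = 0%E.
  apply/eqP; rewrite eq_le ediam_ge0 andbT.
  by apply/ereal_supP => _ [->//|[[x y] [[]]]].
have dU i : (i < n.+1)%N -> (ediam (U i) <= d%:E)%E.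
  rewrite /U => ->; apply: le_trans (ediam_line_part _ e _ _ e1 _) _.
    by rewrite lerD2l ler_wpM2r// ler_nat.
  by rewrite lee_fin -natr1; lra.
apply: (@le_trans _ _ (\sum_(0 <= i <oo) ediam (U i))%E).
  apply: ereal_inf_lbound; exists U => //; split.
    move=> _ [t + <-]; rewrite /= in_itv /= => /andP[lt tr].
    have [|i ni ti] := subdivide l d t n.
      by rewrite lt /d mulrC divfK//= addrC subrK.
    by exists i => //; rewrite /U ni; exists t.
  move=> i; have [/dU h|h] := ltnP i n.+1.
    by apply: le_trans h _; rewrite lee_fin.
  by rewrite /U ltnNge h /= ediam0 lee_fin ltW.
rewrite (nneseries_split 0 n.+1); last by move=> *; exact: ediam_ge0.
rewrite eseries0 ?adde0; last first.
  by move=> i; rewrite add0n => ni _; rewrite /U ltnNge ni.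
rewrite add0n big_mkord.
apply: (@le_trans _ _ (\sum_(i < n.+1) d%:E)%E).
  by apply: lee_sum => i _; exact: dU.
by rewrite sumEFin lee_fin sumr_const card_ord -mulr_natr /d divfK.
Qed.

End Hausdorff.

(** * Connected subsets of a line *)

Section Interval.
Context {R : realType}.
Local Notation plane := (R * R)%type.
Implicit Types (A S H : set plane).

Lemma bounded_closure_coord A : bounded_set A ->
  exists M : R, forall x, closure A x -> `|x.1| <= M /\ `|x.2| <= M.
Proof.
move=> [M [_ bM]]; exists (M + 2) => x /(_ _ (nbhsx_ballx x 1 ltr01)).
move=> [y [yA [/= h1 h2]]].
have : `|y| <= M + 1 by apply: bM => //; lra.
rewrite prod_normE ge_max => /andP[y1 y2].
have n (s t : R) : `|s - t| < 1 -> `|t| <= M + 1 -> `|s| <= M + 2.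
  move=> st tM; rewrite -(subrK t s); apply: le_trans (ler_normD _ _) _; lra.
by split; [exact: n h1 y1|exact: n h2 y2].
Qed.

Lemma dot_coord_le (M : R) (x e : plane) : `|x.1| <= M -> `|x.2| <= M ->
  `|dot x e| <= M * (`|e.1| + `|e.2|).
Proof.
move=> x1 x2; rewrite /dot (le_trans (ler_normD _ _))// !normrM mulrDr.
by rewrite lerD// ler_wpM2r.
Qed.

(** The direction is the normal vector turned by a right angle and normalized;
    the identity for [y] is the decomposition of [y - x] in that frame, where
    the normal component vanishes. *)
Lemma line_direction H : line H -> exists2 e : plane, enorm e = 1 &
  forall x y, H x -> H y -> y = x + dot (y - x) e *: e.
Proof.
move=> [a [b [a0 ->]]].
have n0 : 0 < dot a a.
  rewrite lt_neqAle /dot -!expr2 addr_ge0 ?sqr_ge0// andbT eq_sym.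
  rewrite paddr_eq0 ?sqr_ge0// !sqrf_eq0; apply: contra a0 => /andP[/eqP h1 /eqP h2].
  by rewrite [a]surjective_pairing h1 h2.
have r0 : 0 < enorm a by rewrite sqrtr_gt0.
have r2 : enorm a ^+ 2 = dot a a by rewrite sqr_sqrtr// ltW.
have pn : enorm (perp a) = enorm a.
  by rewrite /enorm; congr Num.sqrt; rewrite /dot /perp /=; ring.
exists ((enorm a)^-1 *: perp a).
  by rewrite enormZ pn gtr0_norm ?invr_gt0// mulVf// gt_eqF.
move=> x y /= ax ay.
have [yx d0] : dot a (y - x) = 0 /\ dot a a != 0.
  split; last by rewrite gt_eqF.
  by rewrite /dot /= in ax ay *; lra.
have -> : dot (y - x) ((enorm a)^-1 *: perp a) *: ((enorm a)^-1 *: perp a) =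
    (dot (y - x) (perp a) / dot a a) *: perp a.
  rewrite scalerA -r2; congr (_ *: _).
  by rewrite /dot /= /GRing.scale /=; field; rewrite gt_eqF.
have [h1 h2] : (y - x).1 * dot a a = dot (y - x) (perp a) * (perp a).1 /\
  (y - x).2 * dot a a = dot (y - x) (perp a) * (perp a).2.
  split; apply/eqP; rewrite -subr_eq0; apply/eqP.
    transitivity (a.1 * dot a (y - x)); last by rewrite yx mulr0.
    by rewrite /dot /perp /=; ring.
  transitivity (a.2 * dot a (y - x)); last by rewrite yx mulr0.
  by rewrite /dot /perp /=; ring.
apply/eqP; rewrite addrC -subr_eq; apply/eqP.
by rewrite [LHS]surjective_pairing -[(y - x).1](mulfK d0) -[(y - x).2](mulfK d0)
  h1 h2; congr pair; rewrite /= /GRing.scale /=; ring.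
Qed.

(** The parameters of the points of [S] form an interval of the reals: its
    infimum and supremum are the parameters of the end points. *)
Lemma connected_line_part H S (M : R) : line H -> S `<=` H -> S !=set0 ->
    connected S -> (forall x, S x -> `|x.1| <= M /\ `|x.2| <= M) ->
  exists p e l r, [/\ enorm e = 1, l <= r, S `<=` line_part p e `[l, r] &
    line_part p e `]l, r[ `<=` S].
Proof.
move=> /line_direction[e e1 He] SH [p Sp] cS bS.
pose f (x : plane) := dot (x - p) e.
have cf : continuous f.
  rewrite (_ : f = fun x => e.1 * x.1 + e.2 * x.2 + - dot p e).
    exact: continuous_affine.
  by apply/funext => x; rewrite /f /dot /=; ring.
pose J := f @` S.
have iJ : is_interval J.
  apply/connected_intervalP; apply: connected_continuous_connected => //.
  exact: continuous_subspaceT.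
pose N := M * (`|e.1| + `|e.2|) + `|dot p e|.
have bJ t : J t -> `|t| <= N.
  move=> [x Sx <-]; have [x1 x2] := bS _ Sx.
  rewrite (_ : f x = dot x e - dot p e); last by rewrite /f /dot /=; ring.
  by rewrite (le_trans (ler_normB _ _))// lerD2r dot_coord_le.
have ubJ : has_ubound J by exists N => t /bJ; rewrite ler_norml => /andP[].
have lbJ : has_lbound J by exists (- N) => t /bJ; rewrite ler_norml => /andP[].
have Jx x : S x -> inf J <= f x <= sup J.
  move=> Sx; have Jfx : J (f x) by exists x.
  by rewrite ge_inf//= ub_le_sup.
exists p, e, (inf J), (sup J); split=> //.
- by have /andP[h1 h2] := Jx _ Sp; exact: le_trans h1 h2.
- by move=> x Sx; exists (f x); [rewrite /= in_itv /= Jx|rewrite -He//; exact: SH].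
- move=> _ [t + <-]; rewrite /= in_itv /= => tJ.
  have : (J°) t by rewrite interval_bounded_interior.
  move=> /interior_subset[x Sx <-]; rewrite -He//; exact: SH.
Qed.

End Interval.

(** * The transmissibilities of an admissible mesh *)

Section Face.
Context {R : realType} {Om : set (R * R)} (m : mesh Om).
Local Notation leb := (@lebesgue_measure R).
Local Notation mu := (leb \x leb)%E.
Implicit Types (K L : cells m) (s : faces m).

Lemma open_cell K : open (cell K).
Proof. by have [[U oU ->] _] := cell_polyhedral K; rewrite setTI. Qed.

Lemma face_boundary K s : s \in faces_of K -> face s `<=` boundary (cell K).
Proof.
move=> sK x sx; rewrite mesh_boundary; exists s => //.
exact: subset_closure.
Qed.

Lemma face_closure_domain s : face s `<=` closure Om.
Proof.
have [K sK] := mesh_faces s => x /(face_boundary _ _ sK)[cx _].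
by rewrite (mesh_cover m); exists K.
Qed.

(** Two cells with the same center would overlap, which the interface condition
    allows only if their common boundary, and hence the face, has length zero. *)
Lemma dcenter_neq0 K L s : K != L -> s \in faces_of K :&: faces_of L ->
  hausdorff1 (face s) != 0%E -> dcenter K L != 0.
Proof.
move=> KL; rewrite inE => /andP[sK sL] s0.
apply/eqP => /eqP; rewrite sqrtr_eq0 => d0.
have cKL : Defs.center K = Defs.center L.
  apply/eqP; rewrite -subr_eq0; set d := _ - _.
  have : (d.1 ^+ 2 + d.2 ^+ 2 == 0).
    by rewrite eq_le addr_ge0 ?sqr_ge0// andbT !expr2.
  rewrite paddr_eq0 ?sqr_ge0// !sqrf_eq0 => /andP[/eqP h1 /eqP h2].
  by rewrite [d]surjective_pairing h1 h2.
case: (mesh_interface KL) => [[_ h]|[_ h]].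
  move/eqP: s0; apply; apply/eqP; rewrite eq_le hausdorff1_ge0 andbT -h.
  apply: le_hausdorff1 => x sx; split; first exact: face_boundary sK _ sx.
  by have [] := face_boundary _ _ sL _ sx.
have : (closure (cell K) `&` closure (cell L)) (Defs.center K).
  split; first exact/subset_closure/center_in.
  by rewrite cKL; exact/subset_closure/center_in.
rewrite h => -[t /=]; rewrite inE => /andP[tK tL] ct.
have : boundary (cell K) (Defs.center K) by rewrite mesh_boundary; exists t.
by case=> _; apply; move: (open_cell K); rewrite openE; apply; exact: center_in.
Qed.

Lemma triangle_diamond (x p e : R * R) (l r : R) s : l < r ->
    line_part p e `]l, r[ `<=` face s ->
  triangle x (p + l *: e) (p + r *: e) `<=` pyramid x (face s).
Proof.
move=> lr sub z /triangle_pyramid[t [rho [t01 /andP[rho0 rho1] ->]]].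
exists (t, p + l *: e + rho *: (p + r *: e - (p + l *: e))) => //.
split=> //=; apply: sub; exists (l + rho * (r - l)).
  by rewrite /= in_itv /=; apply/andP; split; nra.
rewrite opprD addrACA subrr add0r -scalerBl scalerA -addrA -scalerDl.
by [].
Qed.

(** The number [l] is the distance between the end points of the face. Putting it
    between the length and the area requires only an upper bound of the
    Hausdorff measure, for which an explicit covering is enough. *)
Lemma area_diamond_ge K L s : bounded_set Om -> admissible_mesh m ->
    K != L -> s \in faces_of K :&: faces_of L ->
  exists l : R, [/\ 0 <= l, (hausdorff1 (face s) <= l%:E)%E &
    ((l * dcenter K L / 2)%:E <= mu (diamond s K L))%E].
Proof.
move=> bOm adm KL sKL.
have [M bM] := bounded_closure_coord _ bOm.
have [H lH pH] := face_polyhedral s.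
have sH : face s `<=` H by have [[U _ ->] _] := pH; exact: subIsetl.
have [p [e [l [r [e1 lr sub sup]]]]] :=
  connected_line_part _ _ M lH sH (face_neq0 s) (@face_connected _ _ _ s)
    (fun x sx => bM x (face_closure_domain _ _ sx)).
exists (r - l); rewrite subr_ge0; split=> //.
  exact: le_trans (le_hausdorff1 _ _ sub) (hausdorff1_line_part _ _ _ _ e1 lr).
have [lr'|rl] := ltP l r; last first.
  have -> : r - l = 0 by lra.
  by rewrite !mul0r.
(* The end points may not belong to the face: the orthogonality is transferred
   to them from two inner points, a quarter of the length apart. *)
have [m1 m2] : face s (p + ((l + r) / 2) *: e) /\
    face s (p + ((l + r) / 2 + (r - l) / 4) *: e).
  by split; apply: sup; eexists; rewrite //= in_itv /=; apply/andP; split; lra.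
have oe := adm _ _ _ KL sKL _ _ m1 m2.
have {}oe : dot (Defs.center L - Defs.center K) (p + r *: e - (p + l *: e)) = 0.
  rewrite opprD addrACA subrr add0r -scalerBl.
  move: oe; rewrite opprD addrACA subrr add0r -scalerBl addrAC subrr add0r.
  rewrite /dot /= /GRing.scale /= => oe.
  by transitivity (4 * 0 : R); [rewrite -oe; field|rewrite mulr0].
have le : enorm (p + r *: e - (p + l *: e)) = r - l.
  by rewrite opprD addrACA subrr add0r -scalerBl enormZ e1 mulr1 gtr0_norm// subr_gt0.
have sD x : x = Defs.center K \/ x = Defs.center L ->
    triangle x (p + l *: e) (p + r *: e) `<=` diamond s K L.
  move=> xKL; rewrite -open_subsetE; last exact: open_triangle.
  move=> z /(triangle_diamond _ _ _ _ _ _ lr' sup) zx; apply: subset_closure.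
  by case: xKL zx => -> ?; [left|right].
have := kite_area_ge (p + l *: e) (p + r *: e) (Defs.center K) (Defs.center L) (diamond s K L).
rewrite le; apply=> //.
- by apply: measurable_open_plane; exact: open_interior.
- by apply: sD; left.
- by apply: sD; right.
Qed.

(** When the diamond has infinite measure its [area] is zero, and when the face
    has length zero both sides vanish; otherwise the estimate is that of the
    area of the diamond. *)
Lemma transmissibility_ge K L s : bounded_set Om -> admissible_mesh m ->
    K != L -> s \in faces_of K :&: faces_of L ->
  length (face s) ^+ 2 * (area (diamond s K L))^-1 <=
    2 * (length (face s) / dcenter K L).
Proof.
move=> bOm adm KL sKL.
have [l [l0 hl hD]] := area_diamond_ge _ _ _ bOm adm KL sKL.
have dn := dcenter_neq0 _ _ _ KL sKL.
have h0 := hausdorff1_ge0 (face s).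
rewrite /length /area; move: hl dn h0 hD; rewrite -/mu.
case: (hausdorff1 (face s)) => [h| |]//=.
rewrite !lee_fin eqe => hl dn h0.
have [->|hn] := eqVneq h 0; first by rewrite expr0n !mul0r mulr0.
have hp : 0 < h by rewrite lt_neqAle eq_sym hn.
have d0 : 0 < dcenter K L by rewrite lt_neqAle eq_sym dn// sqrtr_ge0.
case: (mu _) => [A| |]//=; last first.
  by rewrite invr0 mulr0 mulr_ge0// divr_ge0// ltW.
rewrite lee_fin => hA.
have A0 : 0 < A.
  by apply: lt_le_trans hA; rewrite divr_gt0// mulr_gt0//; exact: lt_le_trans hl.
rewrite ler_pdivrMr// mulrAC mulrA ler_pdivlMr//.
have : h * dcenter K L <= 2 * A.
  by apply: (@le_trans _ _ (l * dcenter K L)); [rewrite ler_wpM2r// ltW|lra].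
move: (dcenter K L) d0 => d d0; nra.
Qed.

End Face.

(** * Lower bound of the energy *)

Section Energy.
Context {R : realType} {Om : set (R * R)} (m : mesh Om).
Implicit Types (u v w : cells m -> R).

Lemma area_ge0 (A : set (R * R)) : 0 <= area A.
Proof. exact/fine_ge0/measure_ge0. Qed.

(** The Legendre inequality between x ln x - x and exp, which is the tangent
    inequality 1 + t <= exp t at t = y - ln x. *)
Lemma entropy_young (x y : R) : 0 <= x -> x - expR y <= x * ln x - x * y.
Proof.
rewrite le_eqVlt => /predU1P[<-|x0]; first by rewrite !mul0r subr0 sub0r oppr_le0 expR_ge0.
have := expR_ge1Dx (y - ln x).
rewrite expRB lnK// ler_pdivlMr// => h; nra.
Qed.

(** The shift [k] is free: optimizing it would give the Gibbs variational
    principle, with the logarithm of the sum of exponentials. *)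
Lemma gibbs u v (k : R) : (forall K, 0 <= u K) ->
  mass u * (1 + k - average v)
    - expR k * \sum_(K : cells m) area (cell K) * expR `|v K - average v|
  <= \sum_(K : cells m) area (cell K) * (u K * ln (u K) - u K * v K).
Proof.
move=> u0; rewrite /mass mulr_suml mulr_sumr -sumrB.
apply: ler_sum => K _.
set b := average v.
have := entropy_young (u K) (v K - b + k) (u0 K).
have : expR (v K - b + k) <= expR k * expR `|v K - b|.
  by rewrite -expRD ler_expR addrC lerD2l ler_norm.
have a0 := area_ge0 (cell K).
set e1 := expR (_ + _); set e2 := expR k * _ => h1 h2.
rewrite [expR k * _]mulrCA -/e2 -mulrA -mulrBr ler_wpM2l//; lra.
Qed.

Lemma seminorm12_le v : bounded_set Om -> admissible_mesh m ->
  seminorm12 v ^+ 2 <=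
  2 * sum_int (fun s K L => length (face s) / dcenter K L * (v L - v K) ^+ 2).
Proof.
move=> bOm adm; rewrite sqr_sqrtr; last first.
  do 3 (apply: sumr_ge0 => ? _).
  by apply: mulr_ge0; rewrite ?sqr_ge0// mulr_ge0 ?sqr_ge0// invr_ge0 area_ge0.
rewrite /sum_int mulr_sumr; apply: ler_sum => s _.
rewrite mulr_sumr; apply: ler_sum => K _.
rewrite mulr_sumr; apply: ler_sum => L /andP[KL sKL].
rewrite real_normK ?num_real// mulrA ler_wpM2r ?sqr_ge0//.
apply: transmissibility_ge => //.
by apply: contraTneq KL => ->; rewrite ltnn.
Qed.

End Energy.

Theorem proposition7 (R : realType) (Om : set (R * R)) (lambda beta0 M : R)
    (hOm : polyhedral_domain Om)
    (hlambda : 0 < lambda <= 2^-1)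
    (hbeta0 : trudinger_constant Om lambda beta0)
    (hM : M < beta0 / 4) :
  exists delta C : R, 0 < delta /\ 0 < C /\
    forall mu : R, 0 < mu <= 2^-1 ->
    forall m : mesh Om, regular_mesh m mu lambda -> admissible_mesh m ->
    forall u v : cells m -> R,
      (forall K, 0 <= u K) ->
      mass u = M ->
      energy u v >= delta * seminorm12 v ^+ 2 - C - M * average v.
Proof.
have [b0 trudinger] := hbeta0.
have [beta [beta_gt0 beta_lt Mbeta]] :
    exists beta : R, [/\ 0 < beta, beta < beta0 & 4 * M < beta].
  have [M0|M0] := leP M 0; first by exists (beta0 / 2); split; lra.
  by exists (2 * M + beta0 / 2); split; lra.
have [C [C0 hC]] := trudinger _ beta_gt0 beta_lt.
exists (4^-1 - M / beta), (C + `|M|); split.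
  by rewrite subr_gt0 ltr_pdivrMr//; lra.
split; first by rewrite ltr_pwDl.
move=> mu mu0 m reg adm u v u0 uM.
have [_ bOm _ _ _] := hOm.
have := seminorm12_le m v bOm adm.
have := hC _ mu0 m reg v.
have := gibbs m u v (- (beta^-1 * seminorm12 v ^+ 2)) u0.
rewrite /energy uM; set X := seminorm12 v ^+ 2; set S := \sum_(_ | _) _ * expR _.
set H := \sum_(_ | _) _ => h1 h2; set T := sum_int _ => h3.
(* The shift is chosen to cancel the exponential of the Trudinger bound. *)
have h4 : expR (- (beta^-1 * X)) * S <= C.
  rewrite expRN mulrC ler_pdivrMr ?expR_gt0//.
have MM : - M <= `|M| by rewrite -normrN ler_norm.
lra.
Qed.
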